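(* Let $q\in\mathbb{C}$ with $|q|<1$ and $b,d\in\mathbb{C}$. Then \[ \sum_{n=0}^{\infty} \left((bq^n)_{\infty}(dq^n)_{\infty}-(q^{n+1})_{\infty}^2\right) = \sum_{j=1}^{\infty} \frac{q^j}{1-q^j} \sum_{n=0}^{j} {j \brack n}_q \left(\frac{b}{q}\right)_{j-n} \left(\frac{-d}{q}\right)^n q^{n(n-1)/2} - \sum_{j=1}^{\infty} \frac{(-1)^jq^{j(j+1)/2}}{1-q^j}. \]
   Context: $(A)_n=(A;q)_n=\prod_{i=0}^{n-1}(1-Aq^i)$, $(A)_\infty=\prod_{i\ge0}(1-Aq^i)$; ${j \brack n}_q=\frac{(q)_j}{(q)_n(q)_{j-n}}$ is the Gaussian binomial coefficient. *)

(* Defs.v *)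
From Stdlib Require Import Reals.
From Coquelicot Require Import Coquelicot.
Open Scope C_scope.

Fixpoint qpoch (A q : C) (n : nat) : C :=
  match n with
  | O => 1
  | S m => qpoch A q m * (1 - A * q ^ m)
  end.

(* Total limit operator; Clim_unique below shows that it returns the limit of
   every convergent sequence. *)
Definition Clim (u : nat -> C) : C :=
  lim (T := C_CompleteNormedModule) (filtermap u eventually).

Definition qpoch_inf (A q : C) : C := Clim (qpoch A q).

(* Used only for n <= j, where the natural-number subtraction is exact. *)
Definition qbinom (q : C) (j n : nat) : C :=
  qpoch q q j / (qpoch q q n * qpoch q q (j - n)).

Lemma Clim_unique (u : nat -> C) (l : C) :
  filterlim u eventually (locally l) -> Clim u = l.
Proof.
  intros H.
  assert (PF : ProperFilter (filtermap u eventually))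
    by (apply filtermap_proper_filter, eventually_filter).
  assert (HC : cauchy (T := C_UniformSpace) (filtermap u eventually)).
  { intros eps. exists l. apply H. now exists eps. }
  apply (is_filter_lim_unique (F := filtermap u eventually)
           (V := C_NormedModule)); [|exact H].
  intros P [eps HP].
  apply filter_imp with (1 := HP).
  exact (complete_cauchy (T := C_CompleteNormedModule) _ PF HC eps).
Qed.

(* Main.v *)
(** Put [z = q^(n+1)].  By the q-binomial theorem and Euler's expansion,
    [(bz/q)_oo (dz/q)_oo = (z)_oo F(z)], where [F(z) = sum_j c_j z^j] and
    [c_j (q)_j] is the inner sum over [n] of the right-hand side.  Hence the
    [n]-th term on the left is [(z)_oo (F(z) - 1) - (z)_oo (G(z) - 1)] with
    [G(z) = (z)_oo] expanded by Euler.  Interchanging the sums over [n] and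
    [j >= 1] reduces both parts to [sum_n (q^(n+1))_oo q^(nj) = (q)_(j-1)],
    which is the q-binomial theorem at [q^j] multiplied by [(q)_oo]. *)

Require Import Defs.
From Stdlib Require Import Reals Lra Lia.
From Coquelicot Require Import Coquelicot.
Open Scope C_scope.

(** * Complex limits and series, and interchange of summation *)

Notation is_Cseries := (is_series (V := C_NormedModule)).

(** Reduces complex convergence to a real null sequence, so that squeezing and the arithmetic of
    real limits become available. *)
Lemma filterlim_Cmod (u : nat -> C) (l : C) :
  filterlim u eventually (locally (T := C_NormedModule) l) <->
  is_lim_seq (fun n => Cmod (u n - l)) 0.
Proof.
  split; intros H.
  - apply is_lim_seq_spec; intros eps.
    apply (proj1 (filterlim_locally_ball_norm (K := C_AbsRing)
                    (U := C_NormedModule) u l)) with (eps := eps) in H.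
    destruct H as [N HN]; exists N; intros n Hn.
    specialize (HN n Hn).
    rewrite Rminus_0_r, Rabs_pos_eq by apply Cmod_ge_0.
    exact HN.
  - apply (filterlim_locally_ball_norm (K := C_AbsRing)
             (U := C_NormedModule) u l); intros eps.
    apply is_lim_seq_spec in H.
    destruct (H eps) as [N HN]; exists N; intros n Hn.
    specialize (HN n Hn).
    rewrite Rminus_0_r, Rabs_pos_eq in HN by apply Cmod_ge_0.
    exact HN.
Qed.

Lemma is_Cseries_Cmod (a : nat -> C) (l : C) :
  is_Cseries a l <->
  is_lim_seq (fun n => Cmod (sum_n (G := C_AbelianGroup) a n - l)) 0.
Proof. exact (filterlim_Cmod (sum_n (G := C_AbelianGroup) a) l). Qed.

Lemma is_Cseries_unique (a : nat -> C) (l m : C) :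
  is_Cseries a l -> is_Cseries a m -> l = m.
Proof.
  intros Hl Hm.
  exact (filterlim_locally_unique (V := C_NormedModule) _ _ _ Hl Hm).
Qed.

Lemma is_Cseries_ext (a b : nat -> C) (l : C) :
  (forall n, a n = b n) -> is_Cseries a l -> is_Cseries b l.
Proof. intros H; apply is_series_ext; exact H. Qed.

Lemma is_Cseries_mult_l (c : C) (a : nat -> C) (l : C) :
  is_Cseries a l -> is_Cseries (fun n => c * a n) (c * l).
Proof. exact (is_series_scal (V := C_NormedModule) c a l). Qed.

Lemma is_Cseries_plus (a b : nat -> C) (l m : C) :
  is_Cseries a l -> is_Cseries b m -> is_Cseries (fun n => a n + b n) (l + m).
Proof. exact (is_series_plus (V := C_NormedModule) a b l m). Qed.

Lemma is_Cseries_minus (a b : nat -> C) (l m : C) :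
  is_Cseries a l -> is_Cseries b m -> is_Cseries (fun n => a n - b n) (l - m).
Proof. exact (is_series_minus (V := C_NormedModule) a b l m). Qed.

Lemma is_Cseries_tail (a : nat -> C) (l : C) :
  is_Cseries a l -> is_Cseries (fun n => a (S n)) (l - a 0%nat).
Proof.
  intros H; apply (is_series_incr_1 (V := C_NormedModule)).
  change (is_Cseries a (l - a 0%nat + a 0%nat)).
  now replace (l - a 0%nat + a 0%nat) with l by ring.
Qed.

Lemma ex_Cseries_le (a : nat -> C) (b : nat -> R) :
  (forall n, Cmod (a n) <= b n)%R -> ex_series b -> exists l, is_Cseries a l.
Proof.
  intros H Hb.
  exact (ex_series_le (V := C_CompleteNormedModule) a b H Hb).
Qed.

Lemma Cmod_sum_n_le (a : nat -> C) (b : nat -> R) (n : nat) :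
  (forall k, Cmod (a k) <= b k)%R ->
  (Cmod (sum_n (G := C_AbelianGroup) a n) <= sum_n b n)%R.
Proof.
  intros H; induction n as [|n IH].
  - rewrite !sum_O; apply H.
  - rewrite !sum_Sn.
    eapply Rle_trans; [apply Cmod_triangle|].
    apply Rplus_le_compat; [exact IH|apply H].
Qed.

(** [Cmod l] is at most the [n]-th partial sum of [b] plus the distance from [l] to the [n]-th
    partial sum of [a]; let [n] grow. *)
Lemma Cmod_series_le (a : nat -> C) (b : nat -> R) (l : C) (m : R) :
  (forall n, Cmod (a n) <= b n)%R -> is_Cseries a l -> is_series b m ->
  (Cmod l <= m)%R.
Proof.
  intros H Ha Hb.
  apply is_Cseries_Cmod in Ha.
  assert (L := is_lim_seq_plus' _ _ _ _ Hb Ha).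
  rewrite Rplus_0_r in L.
  apply (is_lim_seq_le (fun _ => Cmod l) _ (Cmod l) m) in L.
  - exact L.
  - intros n.
    replace l with (sum_n (G := C_AbelianGroup) a n
                    + - (sum_n (G := C_AbelianGroup) a n - l)) at 1 by ring.
    eapply Rle_trans; [apply Cmod_triangle|].
    rewrite Cmod_opp.
    apply Rplus_le_compat_r, Cmod_sum_n_le, H.
  - apply is_lim_seq_const.
Qed.

Lemma is_Cseries_sum_n (a : nat -> nat -> C) (s : nat -> C) (N : nat) :
  (forall n, is_Cseries (fun j => a j n) (s n)) ->
  is_Cseries (fun j => sum_n (G := C_AbelianGroup) (a j) N)
    (sum_n (G := C_AbelianGroup) s N).
Proof.
  intros H; induction N as [|N IH].
  - rewrite sum_O.
    apply is_Cseries_ext with (2 := H 0%nat); intros j; now rewrite sum_O.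
  - rewrite sum_Sn.
    apply is_Cseries_ext with (2 := is_Cseries_plus _ _ _ _ IH (H (S N))).
    intros j; now rewrite sum_Sn.
Qed.

Lemma Cmod_series_remainder_le (a : nat -> C) (b : nat -> R) (l : C) (m : R)
  (N : nat) :
  (forall n, Cmod (a n) <= b n)%R -> is_Cseries a l -> is_series b m ->
  (Cmod (l - sum_n (G := C_AbelianGroup) a N) <= m - sum_n b N)%R.
Proof.
  intros H Ha Hb.
  apply (Cmod_series_le (fun k => a (S N + k)%nat) (fun k => b (S N + k)%nat)).
  - intros n; apply H.
  - apply (is_series_incr_n (V := C_NormedModule)); [lia|].
    change (is_Cseries a (l - sum_n (G := C_AbelianGroup) a N
                          + sum_n (G := C_AbelianGroup) a N)).
    replace (l - sum_n (G := C_AbelianGroup) a N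
             + sum_n (G := C_AbelianGroup) a N) with l by ring; exact Ha.
  - apply (is_series_incr_n (V := R_NormedModule)); [lia|].
    change (is_series b (m - sum_n b N + sum_n b N)%R).
    replace (m - sum_n b N + sum_n b N)%R with m by ring; exact Hb.
Qed.

(** Domination by a product makes the truncation of the rows uniform: row [j] cut at [N] misses at
    most [x j * (Y - sum_n y N)]. Summed over [j], the error is at most [X * (Y - sum_n y N)], which
    tends to 0. *)
Lemma Cseries_switch (a : nat -> nat -> C) (x y : nat -> R) (r s : nat -> C) :
  ex_series x -> ex_series y ->
  (forall j n, Cmod (a j n) <= x j * y n)%R ->
  (forall j, is_Cseries (a j) (r j)) ->
  (forall n, is_Cseries (fun j => a j n) (s n)) ->
  exists l, is_Cseries r l /\ is_Cseries s l.
Proof.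
  intros [X HX] [Y HY] Hxy Hr Hs.
  assert (Hrow : forall j N,
    (Cmod (r j - sum_n (G := C_AbelianGroup) (a j) N)
     <= x j * (Y - sum_n y N))%R).
  { intros j N.
    assert (E : (x j * (Y - sum_n y N) =
                 x j * Y - sum_n (fun n => x j * y n) N)%R).
    { assert (M : sum_n (fun n => x j * y n)%R N = (x j * sum_n y N)%R)
        by exact (sum_n_mult_l (K := R_Ring) (x j) y N).
      rewrite M; ring. }
    rewrite E; apply Cmod_series_remainder_le; [apply Hxy|apply Hr|].
    exact (is_series_scal (V := R_NormedModule) (x j) y Y HY). }
  (* Each row sum is at most [x j * Y] in modulus, so the row sums converge absolutely. *)
  destruct (ex_Cseries_le r (fun j => x j * Y)%R) as [l Hl].
  { intros j.
    apply Cmod_series_le with (2 := Hr j) (b := fun n => (x j * y n)%R).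
    - apply Hxy.
    - exact (is_series_scal (V := R_NormedModule) (x j) y Y HY). }
  { exists (X * Y)%R. exact (is_series_scal_r Y x X HX). }
  exists l; split; [exact Hl|].
  apply is_Cseries_Cmod.
  apply is_lim_seq_le_le with (u := fun _ => 0%R)
    (w := fun N => (X * (Y - sum_n y N))%R).
  - intros N; split; [apply Cmod_ge_0|].
    replace (sum_n (G := C_AbelianGroup) s N - l)
      with (- (l - sum_n (G := C_AbelianGroup) s N)) by ring.
    rewrite Cmod_opp.
    apply Cmod_series_le with
      (a := fun j => r j - sum_n (G := C_AbelianGroup) (a j) N)
      (b := fun j => (x j * (Y - sum_n y N))%R).
    + intros j; apply Hrow.
    + apply is_Cseries_minus; [exact Hl|now apply is_Cseries_sum_n].
    + exact (is_series_scal_r (Y - sum_n y N)%R x X HX).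
  - apply is_lim_seq_const.
  - replace (Finite 0) with (Rbar_mult X 0) by (simpl; f_equal; ring).
    apply is_lim_seq_scal_l.
    replace 0%R with (Y - Y)%R by ring.
    apply is_lim_seq_minus'; [apply is_lim_seq_const|exact HY].
Qed.

(** * Cauchy products *)

Definition Cconv (u v : nat -> C) (k : nat) : C :=
  sum_n (G := C_AbelianGroup) (fun n => u n * v (k - n)%nat) k.

(** Summation over the triangle by rows instead of diagonals. It is stated over any ring to serve
    both the complex sequences and their moduli. *)
Lemma sum_n_conv (K : Ring) (u v : nat -> K) (N : nat) :
  sum_n (fun k => sum_n (fun n => mult (u n) (v (k - n)%nat)) k) N =
  sum_n (fun n => mult (u n) (sum_n v (N - n))) N.
Proof.
  induction N as [|N IH].
  - now rewrite !sum_O.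
  - rewrite !sum_Sn, IH, Nat.sub_diag, sum_O, plus_assoc; f_equal.
    rewrite <- sum_n_plus.
    apply sum_n_ext_loc; intros n Hn.
    replace (S N - n)%nat with (S (N - n)) by lia.
    now rewrite sum_Sn, mult_distr_l.
Qed.

(* The products [u n * v k] missing from the truncated convolution have
   [n, k <= N < n + k]; the same products of moduli appear on the right. *)
Lemma Cmod_conv_defect_le (u v : nat -> C) (N : nat) :
  (Cmod (sum_n (G := C_AbelianGroup) u N * sum_n (G := C_AbelianGroup) v N
         - sum_n (G := C_AbelianGroup) (Cconv u v) N)
   <= sum_n (fun n => Cmod (u n)) N * sum_n (fun n => Cmod (v n)) N
      - sum_n (fun k => sum_n (fun n => Cmod (u n) * Cmod (v (k - n)%nat)) k) N)%R.
Proof.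
  assert (HC := sum_n_conv C_Ring u v N).
  assert (HR := sum_n_conv R_Ring (fun n => Cmod (u n)) (fun n => Cmod (v n)) N).
  change (sum_n (G := C_AbelianGroup) (Cconv u v) N =
    sum_n (G := C_AbelianGroup)
      (fun n => u n * sum_n (G := C_AbelianGroup) v (N - n)) N) in HC.
  change (sum_n (fun k => sum_n (fun n => Cmod (u n) * Cmod (v (k - n)%nat))%R k) N =
    sum_n (fun n => Cmod (u n) * sum_n (fun n => Cmod (v n)) (N - n))%R N) in HR.
  rewrite HC, HR; clear HC HR.
  assert (T : forall m, (m <= N)%nat ->
    (Cmod (sum_n (G := C_AbelianGroup) v N - sum_n (G := C_AbelianGroup) v m)
     <= sum_n (fun n => Cmod (v n)) N - sum_n (fun n => Cmod (v n)) m)%R).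
  { intros m Hm; induction Hm as [|M Hm IH].
    - replace (sum_n (G := C_AbelianGroup) v m - sum_n (G := C_AbelianGroup) v m)
        with (RtoC 0) by ring.
      rewrite Cmod_0; lra.
    - rewrite !sum_Sn; unfold plus; simpl.
      replace (sum_n (G := C_AbelianGroup) v M + v (S M)
               - sum_n (G := C_AbelianGroup) v m)
        with (sum_n (G := C_AbelianGroup) v M
              - sum_n (G := C_AbelianGroup) v m + v (S M)) by ring.
      eapply Rle_trans; [apply Cmod_triangle|]; lra. }
  set (VN := sum_n (G := C_AbelianGroup) v N) in *.
  set (WN := sum_n (fun n => Cmod (v n)) N) in *.
  (* Only the outer range varies in this induction; the inner sums keep their reference to [N]
     through [VN], [WN] and [N - n]. *)
  assert (H : forall M,
    (Cmod (sum_n (G := C_AbelianGroup) u M * VN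
           - sum_n (G := C_AbelianGroup)
               (fun n => (u n * sum_n (G := C_AbelianGroup) v (N - n))%C) M)
     <= sum_n (fun n => Cmod (u n)) M * WN
        - sum_n (fun n => Cmod (u n) * sum_n (fun n => Cmod (v n)) (N - n)) M)%R);
    [|apply H].
  assert (D : forall n,
    (Cmod (u n * VN - u n * sum_n (G := C_AbelianGroup) v (N - n))
     <= Cmod (u n) * WN - Cmod (u n) * sum_n (fun n => Cmod (v n)) (N - n))%R).
  { intros n.
    replace (u n * VN - u n * sum_n (G := C_AbelianGroup) v (N - n))
      with (u n * (VN - sum_n (G := C_AbelianGroup) v (N - n))) by ring.
    rewrite Cmod_mult, <- Rmult_minus_distr_l.
    apply Rmult_le_compat_l; [apply Cmod_ge_0|apply T; lia]. }
  intros M; induction M as [|M IH].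
  - rewrite !sum_O; apply D.
  - rewrite !sum_Sn; unfold plus; simpl.
    specialize (D (S M)).
    match goal with |- (Cmod ((?A + ?B) * ?V - (?E + ?F)) <= _)%R =>
      replace ((A + B) * V - (E + F)) with ((A * V - E) + (B * V - F)) by ring
    end.
    eapply Rle_trans; [apply Cmod_triangle|]; lra.
Qed.

Lemma is_series_conv_Cmod (u v : nat -> C) (x y : R) :
  is_series (fun n => Cmod (u n)) x -> is_series (fun n => Cmod (v n)) y ->
  is_series
    (fun k => sum_n (fun n => Cmod (u n) * Cmod (v (k - n)%nat))%R k) (x * y)%R.
Proof.
  intros Hu Hv.
  assert (A : forall w : nat -> C, forall z, is_series (fun n => Cmod (w n)) z ->
            ex_series (fun n => Rabs (Cmod (w n)))).
  { intros w z Hw; exists z; apply is_series_ext with (2 := Hw).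
    intros n; symmetry; apply Rabs_pos_eq, Cmod_ge_0. }
  apply is_series_ext with
    (2 := is_series_mult _ _ _ _ Hu Hv (A _ _ Hu) (A _ _ Hv)).
  intros n; now rewrite <- sum_n_Reals.
Qed.

Lemma Cmod_mult_lim (u v : nat -> C) (l m : C) :
  is_lim_seq (fun n => Cmod (u n - l)) 0 ->
  is_lim_seq (fun n => Cmod (v n - m)) 0 ->
  is_lim_seq (fun n => Cmod (u n * v n - l * m)) 0.
Proof.
  intros Hu Hv.
  apply is_lim_seq_le_le with (u := fun _ => 0%R)
    (w := fun n => (Cmod (u n - l) * Cmod (v n - m)
                    + (Cmod (u n - l) * Cmod m + Cmod l * Cmod (v n - m)))%R).
  - intros n; split; [apply Cmod_ge_0|].
    replace (u n * v n - l * m)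
      with ((u n - l) * (v n - m) + ((u n - l) * m + l * (v n - m))) by ring.
    eapply Rle_trans; [apply Cmod_triangle|].
    rewrite Cmod_mult; apply Rplus_le_compat_l.
    eapply Rle_trans; [apply Cmod_triangle|].
    rewrite !Cmod_mult; lra.
  - apply is_lim_seq_const.
  - replace 0%R with (0 * 0 + (0 * Cmod m + Cmod l * 0))%R by ring.
    repeat apply is_lim_seq_plus'; apply is_lim_seq_mult';
      auto using is_lim_seq_const.
Qed.

(** The defect of the truncated product is bounded by the same defect for the moduli, which tends to
    [x * y - x * y] by the real Cauchy product theorem. *)
Lemma is_Cseries_conv (u v : nat -> C) (l m : C) :
  is_Cseries u l -> is_Cseries v m ->
  ex_series (fun n => Cmod (u n)) -> ex_series (fun n => Cmod (v n)) ->
  is_Cseries (Cconv u v) (l * m) /\ ex_series (fun k => Cmod (Cconv u v k)).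
Proof.
  intros Hu Hv [x Hx] [y Hy].
  assert (Hxy := is_series_conv_Cmod u v x y Hx Hy).
  split.
  - apply is_Cseries_Cmod in Hu; apply is_Cseries_Cmod in Hv.
    assert (P := Cmod_mult_lim _ _ _ _ Hu Hv).
    apply is_Cseries_Cmod.
    assert (Q := is_lim_seq_minus' _ _ _ _ (is_lim_seq_mult' _ _ _ _ Hx Hy) Hxy).
    assert (S := is_lim_seq_plus' _ _ _ _ P Q).
    replace (0 + (x * y - x * y))%R with 0%R in S by ring.
    apply is_lim_seq_le_le with (u := fun _ => 0%R) (3 := S);
      [|apply is_lim_seq_const].
    intros n; split; [apply Cmod_ge_0|].
    assert (D := Cmod_conv_defect_le u v n).
    match goal with |- (Cmod ?A <= Cmod ?B + _)%R =>
      replace A with (B + - (sum_n (G := C_AbelianGroup) u n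
                             * sum_n (G := C_AbelianGroup) v n
                             - sum_n (G := C_AbelianGroup) (Cconv u v) n))
        by ring
    end.
    eapply Rle_trans; [apply Cmod_triangle|].
    rewrite Cmod_opp; apply Rplus_le_compat_l; exact D.
  - apply (ex_series_le (V := R_CompleteNormedModule)) with
      (2 := ex_intro _ _ Hxy).
    intros k; unfold norm; simpl; unfold abs; simpl.
    rewrite Rabs_pos_eq by apply Cmod_ge_0.
    apply Cmod_sum_n_le; intros n; rewrite Cmod_mult; lra.
Qed.

(** * The limit operator, uniqueness of limits and the ratio test *)

Lemma is_Cseries_Clim (a : nat -> C) :
  (exists l, is_Cseries a l) ->
  is_Cseries a (Clim (sum_n (G := C_AbelianGroup) a)).
Proof.
  intros [l Hl].
  now rewrite (Clim_unique (sum_n (G := C_AbelianGroup) a) l Hl).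
Qed.

Lemma Cmod_lim_unique (u : nat -> C) (l m : C) :
  is_lim_seq (fun n => Cmod (u n - l)) 0 ->
  is_lim_seq (fun n => Cmod (u n - m)) 0 -> l = m.
Proof.
  intros Hl Hm.
  exact (filterlim_locally_unique (V := C_NormedModule) _ _ _
           (proj2 (filterlim_Cmod u l) Hl) (proj2 (filterlim_Cmod u m) Hm)).
Qed.

Lemma Clim_Cmod (u : nat -> C) (l : C) :
  is_lim_seq (fun n => Cmod (u n - l)) 0 -> Clim u = l.
Proof. intros H; apply Clim_unique, filterlim_Cmod, H. Qed.

(** The ratio condition is written without division because terms may vanish, as the coefficients
    below do when [al = be * q ^ n] for some [n]. *)
Lemma ex_series_ratio (v : nat -> R) (rho : R) (N : nat) :
  (0 <= rho < 1)%R -> (forall n, 0 <= v n)%R ->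
  (forall n, (N <= n)%nat -> v (S n) <= rho * v n)%R -> ex_series v.
Proof.
  intros Hrho Hpos H.
  apply (ex_series_incr_n (V := R_NormedModule) v N).
  apply (ex_series_le (V := R_CompleteNormedModule)) with
    (b := fun k => (rho ^ k * v N)%R).
  - intros k; unfold norm; simpl; unfold abs; simpl.
    rewrite Rabs_pos_eq by apply Hpos.
    induction k as [|k IH].
    + rewrite Nat.add_0_r; simpl; lra.
    + rewrite Nat.add_succ_r; simpl.
      eapply Rle_trans; [apply H; lia|].
      rewrite Rmult_assoc; apply Rmult_le_compat_l; [lra|exact IH].
  - exists (/ (1 - rho) * v N)%R.
    apply (is_series_scal_r (v N) (fun k => rho ^ k)%R).
    apply is_series_geom; rewrite Rabs_pos_eq; lra.
Qed.

(** * Elementary facts on finite q-Pochhammer symbols *)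

Lemma Cmod_pow_S_lt_1 (q : C) (n : nat) :
  (Cmod q < 1)%R -> (Cmod (q ^ S n) < 1)%R.
Proof.
  intros hq; rewrite Cmod_pow.
  apply pow_lt_1_compat; [split; [apply Cmod_ge_0|exact hq]|lia].
Qed.

Lemma Cmod_pow_le_1 (q : C) (n : nat) :
  (Cmod q < 1)%R -> (Cmod (q ^ n) <= 1)%R.
Proof.
  intros hq; destruct n; [simpl; rewrite Cmod_1; lra|].
  now apply Rlt_le, Cmod_pow_S_lt_1.
Qed.

Lemma one_minus_neq_0 (x : C) : (Cmod x < 1)%R -> 1 - x <> 0.
Proof.
  intros Hx H.
  replace x with (RtoC 1) in Hx; [rewrite Cmod_1 in Hx; lra|].
  replace x with (1 - (1 - x)) by ring; rewrite H; ring.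
Qed.

Lemma qpoch_qq_neq_0 (q : C) (n : nat) :
  (Cmod q < 1)%R -> qpoch q q n <> 0.
Proof.
  intros hq; induction n as [|n IH]; simpl.
  - intros H; apply RtoC_inj in H; lra.
  - apply Cmult_neq_0; [exact IH|].
    apply one_minus_neq_0; exact (Cmod_pow_S_lt_1 q n hq).
Qed.

Lemma qpoch_0 (q : C) (n : nat) : qpoch 0 q n = 1.
Proof. induction n as [|n IH]; simpl; [|rewrite IH]; ring. Qed.

Lemma qpoch_add (A q : C) (n m : nat) :
  qpoch A q (n + m) = qpoch A q n * qpoch (A * q ^ n) q m.
Proof.
  induction m as [|m IH]; simpl.
  - rewrite Nat.add_0_r; ring.
  - rewrite Nat.add_succ_r; simpl; rewrite IH, Cpow_add_r; ring.
Qed.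

(** * First-order q-difference equations *)

(* Coefficients of the power series solution [f(z) = sum u_n z^n], [f(0) = 1],
   of the q-difference equation [(1 - al z) f(z) = (1 - be z) f(q z)]. *)
Definition qdiff_coef (q al be : C) (u : nat -> C) : Prop :=
  u 0%nat = 1 /\
  forall n, u (S n) * (1 - q ^ S n) = u n * (al - be * q ^ n).

(** By the recurrence, consecutive terms have ratio [(al * z - be * z * q ^ n) / (1 - q ^ S n)],
    whose modulus tends to that of [al * z]. *)
Lemma qdiff_coef_abs_cvg (q al be z : C) (u : nat -> C) :
  (Cmod q < 1)%R -> qdiff_coef q al be u -> (Cmod (al * z) < 1)%R ->
  ex_series (fun n => Cmod (u n * z ^ n)).
Proof.
  intros hq [_ Hu] Hz.
  set (r := Cmod q) in *.
  assert (Hr : (0 <= r)%R) by apply Cmod_ge_0.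
  set (t := Cmod (al * z)) in *.
  assert (Ht : (0 <= t)%R) by apply Cmod_ge_0.
  assert (G : is_lim_seq (fun n => r ^ n)%R 0)
    by (apply is_lim_seq_geom; rewrite Rabs_pos_eq; lra).
  assert (G1 := proj1 (is_lim_seq_incr_1 _ _) G).
  (* A real upper bound for the modulus of the ratio, with limit [t < 1]. *)
  assert (L : is_lim_seq
    (fun n => (t + Cmod (be * z) * r ^ n) / (1 - r ^ S n))%R t).
  { replace (Finite t)
      with (Finite ((t + Cmod (be * z) * 0) / (1 - 0))) by (f_equal; field).
    apply is_lim_seq_div'; [| |lra].
    - apply is_lim_seq_plus'; [apply is_lim_seq_const|].
      apply is_lim_seq_mult'; [apply is_lim_seq_const|exact G].
    - apply is_lim_seq_minus'; [apply is_lim_seq_const|exact G1]. }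
  apply is_lim_seq_spec in L.
  (* With this tolerance the bound stays below [t + (1 - t) / 2 = (1 + t) / 2], the ratio used in
     the test. *)
  assert (He : (0 < (1 - t) / 2)%R) by lra.
  destruct (L (mkposreal _ He)) as [N HN]; simpl in HN.
  apply ex_series_ratio with (rho := ((1 + t) / 2)%R) (N := N);
    [lra|intros n; apply Cmod_ge_0|].
  intros n Hn; specialize (HN n Hn).
  apply Rabs_lt_between in HN.
  assert (Hd : (0 < 1 - r ^ S n)%R).
  { assert (H := Cmod_pow_S_lt_1 q n hq); rewrite Cmod_pow in H.
    fold r in H; lra. }
  assert (Hdq : (1 - r ^ S n <= Cmod (1 - q ^ S n))%R).
  { assert (H := Cmod_triangle (1 - q ^ S n) (q ^ S n)).
    replace (1 - q ^ S n + q ^ S n) with (RtoC 1) in H by ring.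
    rewrite Cmod_1, Cmod_pow in H; fold r in H; lra. }
  assert (Hnum : (Cmod (al * z - be * z * q ^ n)
                  <= t + Cmod (be * z) * r ^ n)%R).
  { unfold Cminus.
    eapply Rle_trans; [apply Cmod_triangle|].
    rewrite Cmod_opp, (Cmod_mult (be * z)), Cmod_pow; fold t r; lra. }
  assert (Hq : (t + Cmod (be * z) * r ^ n
                <= (1 + t) / 2 * (1 - r ^ S n))%R).
  { apply Rle_div_l; [lra|]; simpl in *; lra. }
  assert (E : (Cmod (u (S n) * z ^ S n) * Cmod (1 - q ^ S n)
               = Cmod (u n * z ^ n) * Cmod (al * z - be * z * q ^ n))%R).
  { rewrite <- !Cmod_mult; f_equal; simpl (z ^ S n).
    transitivity (u (S n) * (1 - q ^ S n) * (z * z ^ n)); [ring|].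
    rewrite Hu; ring. }
  assert (P1 := Cmod_ge_0 (u (S n) * z ^ S n)).
  assert (P2 := Cmod_ge_0 (u n * z ^ n)).
  apply Rmult_le_reg_r with (1 - r ^ S n)%R; [exact Hd|].
  apply Rle_trans with (Cmod (u (S n) * z ^ S n) * Cmod (1 - q ^ S n))%R;
    [now apply Rmult_le_compat_l|].
  rewrite E.
  replace ((1 + t) / 2 * Cmod (u n * z ^ n) * (1 - r ^ S n))%R
    with (Cmod (u n * z ^ n) * ((1 + t) / 2 * (1 - r ^ S n)))%R by ring.
  apply Rmult_le_compat_l; lra.
Qed.

(** The series of f(z) - f(qz) has coefficients [u n * (1 - q ^ n)] and no constant term; shifting
    the index and applying the recurrence gives z (al f(z) - be f(qz)). *)
Lemma qdiff_step (q al be z f f' : C) (u : nat -> C) :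
  qdiff_coef q al be u ->
  is_Cseries (fun n => u n * z ^ n) f ->
  is_Cseries (fun n => u n * (q * z) ^ n) f' ->
  (1 - al * z) * f = (1 - be * z) * f'.
Proof.
  intros [_ Hu] Hf Hf'.
  assert (H1 := is_Cseries_tail _ _ (is_Cseries_minus _ _ _ _ Hf Hf')).
  assert (H2 := is_Cseries_mult_l z _ _
    (is_Cseries_minus _ _ _ _ (is_Cseries_mult_l al _ _ Hf)
       (is_Cseries_mult_l be _ _ Hf'))).
  assert (E : f - f' - (u 0%nat * z ^ 0 - u 0%nat * (q * z) ^ 0)
              = z * (al * f - be * f')).
  { apply is_Cseries_unique with (1 := H1).
    apply is_Cseries_ext with (2 := H2); intros n.
    rewrite !Cpow_mult_l; simpl (z ^ S n).
    transitivity (u n * (al - be * q ^ n) * (z * z ^ n)); [ring|].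
    rewrite <- Hu; ring. }
  simpl in E.
  replace ((1 - al * z) * f)
    with (f - f' - (u 0%nat * 1 - u 0%nat * 1) + f' - z * al * f) by ring.
  rewrite E; ring.
Qed.

(** [F n] is the value of the power series at [q ^ n * z]; the functional equations at these points
    telescope. *)
Lemma qdiff_iter (q al be z : C) (u F : nat -> C) (N : nat) :
  qdiff_coef q al be u ->
  (forall n, is_Cseries (fun k => u k * (q ^ n * z) ^ k) (F n)) ->
  qpoch (al * z) q N * F 0%nat = qpoch (be * z) q N * F N.
Proof.
  intros Hu HF; induction N as [|N IH]; [reflexivity|]; simpl.
  assert (E : (1 - al * (q ^ N * z)) * F N = (1 - be * (q ^ N * z)) * F (S N)).
  { apply (qdiff_step q al be (q ^ N * z) _ _ u Hu); [apply HF|].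
    apply is_Cseries_ext with (2 := HF (S N)); intros n; simpl (q ^ S N).
    now rewrite Cmult_assoc. }
  transitivity ((1 - al * (q ^ N * z)) * (qpoch (al * z) q N * F 0%nat));
    [ring|rewrite IH].
  transitivity (qpoch (be * z) q N * ((1 - al * (q ^ N * z)) * F N));
    [ring|rewrite E; ring].
Qed.

Lemma Cmod_term_le (q z : C) (u : nat -> C) (N n : nat) :
  (Cmod q < 1)%R -> (Cmod (u n * (q ^ N * z) ^ n) <= Cmod (u n * z ^ n))%R.
Proof.
  intros hq.
  rewrite Cpow_mult_l, <- Cpow_mult_r, !Cmod_mult.
  apply Rmult_le_compat_l; [apply Cmod_ge_0|].
  rewrite <- (Rmult_1_l (Cmod (z ^ n))) at 2.
  apply Rmult_le_compat_r; [apply Cmod_ge_0|].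
  now apply Cmod_pow_le_1.
Qed.

(** Continuity at 0 along [q ^ n * z]: every term after the constant one carries a factor [q ^ n],
    so the tail is at most [Cmod q ^ n] times a fixed sum. *)
Lemma power_series_lim_0 (q z : C) (u F : nat -> C) :
  (Cmod q < 1)%R -> u 0%nat = 1 -> ex_series (fun n => Cmod (u n * z ^ n)) ->
  (forall n, is_Cseries (fun k => u k * (q ^ n * z) ^ k) (F n)) ->
  is_lim_seq (fun n => Cmod (F n - 1)) 0.
Proof.
  intros hq Hu0 Hz HF.
  apply (ex_series_incr_1 (V := R_NormedModule)) in Hz.
  destruct Hz as [M HM].
  apply is_lim_seq_le_le with (u := fun _ => 0%R)
    (w := fun n => (Cmod q ^ n * M)%R).
  - intros n; split; [apply Cmod_ge_0|].
    assert (T := is_Cseries_tail _ _ (HF n)).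
    cbv beta in T; rewrite Hu0 in T; simpl (_ ^ 0) in T; rewrite Cmult_1_l in T.
    apply (Cmod_series_le _ (fun k => Cmod q ^ n * Cmod (u (S k) * z ^ S k))%R)
      with (2 := T).
    + intros k.
      rewrite <- Cmod_pow, <- Cmod_mult.
      replace (u (S k) * (q ^ n * z) ^ S k)
        with (q ^ n * (u (S k) * z * (q ^ n * z) ^ k)) by (simpl; ring).
      rewrite !(Cmod_mult (q ^ n)).
      apply Rmult_le_compat_l; [apply Cmod_ge_0|].
      eapply Rle_trans;
        [apply (Cmod_term_le q z (fun k => u (S k) * z) n k hq)|].
      apply Req_le; f_equal; simpl; ring.
    + exact (is_series_scal (V := R_NormedModule) (Cmod q ^ n)%R _ _ HM).
  - apply is_lim_seq_const.
  - replace (Finite 0) with (Rbar_mult 0 M) by (simpl; f_equal; ring).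
    apply is_lim_seq_scal_r, is_lim_seq_geom.
    rewrite Rabs_pos_eq; [exact hq|apply Cmod_ge_0].
Qed.

(** The iteration is kept at finite [N], since the convergence of the infinite products is only
    deduced from this lemma, in [euler_qpoch]. *)
Lemma qdiff_solution (q al be z : C) (u : nat -> C) :
  (Cmod q < 1)%R -> qdiff_coef q al be u -> (Cmod (al * z) < 1)%R ->
  exists F : nat -> C,
    (forall n, is_Cseries (fun k => u k * (q ^ n * z) ^ k) (F n)) /\
    is_lim_seq (fun n => Cmod (F n - 1)) 0 /\
    (forall N, qpoch (al * z) q N * F 0%nat = qpoch (be * z) q N * F N).
Proof.
  intros hq Hu Hz.
  assert (A := qdiff_coef_abs_cvg q al be z u hq Hu Hz).
  (* [Clim] names the sums for all [n] at once, without a choice principle. *)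
  exists (fun n => Clim (sum_n (G := C_AbelianGroup)
                           (fun k => u k * (q ^ n * z) ^ k))).
  match goal with |- ?P /\ _ => assert (HF : P) end.
  { intros n; apply is_Cseries_Clim.
    apply ex_Cseries_le with (2 := A); intros k; now apply Cmod_term_le. }
  split; [exact HF|split].
  - apply (power_series_lim_0 q z u) with (4 := HF); [exact hq|apply Hu|exact A].
  - intros N.
    exact (qdiff_iter q al be z u
             (fun n => Clim (sum_n (G := C_AbelianGroup)
                               (fun k => u k * (q ^ n * z) ^ k))) N Hu HF).
Qed.

(** * Euler's expansion, the q-binomial theorem and infinite products *)

(** The coefficient of z^n in (dz)_oo. *)
Definition euler_coef (q d : C) (n : nat) : C :=
  (- d) ^ n * q ^ (n * (n - 1) / 2) / qpoch q q n.

(** The coefficient of z^n in (az)_oo / (z)_oo. *)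
Definition binomial_coef (q a : C) (n : nat) : C := qpoch a q n / qpoch q q n.

Lemma triangular_S (n : nat) :
  (S n * (S n - 1) / 2 = n * (n - 1) / 2 + n)%nat.
Proof.
  rewrite Nat.sub_succ, Nat.sub_0_r.
  rewrite <- Nat.div_add by lia; f_equal; destruct n; lia.
Qed.

Lemma qpoch_qq_S (q : C) (n : nat) :
  qpoch q q (S n) = qpoch q q n * (1 - q ^ S n).
Proof. reflexivity. Qed.

Lemma euler_coef_qdiff (q d : C) :
  (Cmod q < 1)%R -> qdiff_coef q 0 d (euler_coef q d).
Proof.
  intros hq; split.
  - unfold euler_coef; simpl; field.
  - intros n; unfold euler_coef.
    rewrite triangular_S, Cpow_add_r, qpoch_qq_S.
    rewrite (Cpow_S (- d)).
    assert (H1 := qpoch_qq_neq_0 q n hq).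
    assert (H2 := one_minus_neq_0 _ (Cmod_pow_S_lt_1 q n hq)).
    rewrite Cpow_S in *; field; split; assumption.
Qed.

Lemma binomial_coef_qdiff (q a : C) :
  (Cmod q < 1)%R -> qdiff_coef q 1 a (binomial_coef q a).
Proof.
  intros hq; split.
  - unfold binomial_coef; simpl; field.
  - intros n; unfold binomial_coef; rewrite qpoch_qq_S.
    simpl (qpoch a q (S n)).
    assert (H1 := qpoch_qq_neq_0 q n hq).
    assert (H2 := one_minus_neq_0 _ (Cmod_pow_S_lt_1 q n hq)).
    rewrite Cpow_S in *; field; split; assumption.
Qed.

(** Avoids dividing by [h n]: once [h n] is within 1/2 of 1, [P n] is at most [2 * Cmod G] in
    modulus, and [P n - G = - (P n * (h n - 1))]. *)
Lemma Cmod_lim_of_mult (P h : nat -> C) (G : C) :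
  (forall n, P n * h n = G) ->
  is_lim_seq (fun n => Cmod (h n - 1)) 0 ->
  is_lim_seq (fun n => Cmod (P n - G)) 0.
Proof.
  intros HP Hh.
  apply is_lim_seq_le_le_loc with (u := fun _ => 0%R)
    (w := fun n => (2 * Cmod G * Cmod (h n - 1))%R).
  - assert (Hh' := proj2 (is_lim_seq_spec _ _) Hh).
    assert (He : (0 < 1 / 2)%R) by lra.
    destruct (Hh' (mkposreal _ He)) as [N HN]; simpl in HN.
    exists N; intros n Hn; specialize (HN n Hn).
    rewrite Rminus_0_r, Rabs_pos_eq in HN by apply Cmod_ge_0.
    split; [apply Cmod_ge_0|].
    assert (B : (Cmod (P n) <= 2 * Cmod G)%R).
    { assert (T : (Cmod (P n) <= Cmod G + Cmod (P n) * Cmod (h n - 1))%R).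
      { rewrite <- Cmod_mult, <- (Cmod_opp (P n * (h n - 1))).
        replace (P n) with (G + - (P n * (h n - 1))) at 1
          by (rewrite <- (HP n); ring).
        apply Cmod_triangle. }
      assert (P0 := Cmod_ge_0 (P n)); nra. }
    replace (P n - G) with (- (P n * (h n - 1))) by (rewrite <- (HP n); ring).
    rewrite Cmod_opp, Cmod_mult.
    apply Rmult_le_compat_r; [apply Cmod_ge_0|exact B].
  - apply is_lim_seq_const.
  - replace (Finite 0) with (Rbar_mult (2 * Cmod G)%R 0)
      by (simpl; f_equal; ring).
    now apply is_lim_seq_scal_l.
Qed.

(** For [al = 0] the iteration reads [F 0 = qpoch A q N * F N] with [F N] tending to 1. This yields
    both the convergence of the product and Euler's series for it. *)
Lemma euler_qpoch (q A : C) :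
  (Cmod q < 1)%R ->
  is_lim_seq (fun n => Cmod (qpoch A q n - qpoch_inf A q)) 0 /\
  is_Cseries (fun k => euler_coef q 1 k * A ^ k) (qpoch_inf A q).
Proof.
  intros hq.
  destruct (qdiff_solution q 0 1 A (euler_coef q 1) hq (euler_coef_qdiff q 1 hq))
    as (F & HF & HF1 & HFN).
  { rewrite Cmult_0_l, Cmod_0; lra. }
  assert (L : is_lim_seq (fun n => Cmod (qpoch A q n - F 0%nat)) 0).
  { apply Cmod_lim_of_mult with (h := F); [|exact HF1].
    intros n; specialize (HFN n).
    rewrite Cmult_0_l, qpoch_0, !Cmult_1_l in HFN; now symmetry. }
  assert (E : qpoch_inf A q = F 0%nat) by exact (Clim_Cmod _ _ L).
  rewrite E; split; [exact L|].
  apply is_Cseries_ext with (2 := HF 0%nat); intros n; simpl (q ^ 0).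
  now rewrite Cmult_1_l.
Qed.

(** The limit of [qdiff_solution] as [N] grows. The multiplied form avoids proving that
    [qpoch_inf (al * z) q] is nonzero. *)
Lemma qdiff_qpoch (q al be z : C) (u : nat -> C) :
  (Cmod q < 1)%R -> qdiff_coef q al be u -> (Cmod (al * z) < 1)%R ->
  exists f, is_Cseries (fun k => u k * z ^ k) f /\
            qpoch_inf (al * z) q * f = qpoch_inf (be * z) q.
Proof.
  intros hq Hu Hz.
  destruct (qdiff_solution q al be z u hq Hu Hz) as (F & HF & HF1 & HFN).
  exists (F 0%nat); split.
  - apply is_Cseries_ext with (2 := HF 0%nat); intros n; simpl (q ^ 0).
    now rewrite Cmult_1_l.
  - assert (L1 := Cmod_mult_lim _ _ _ _ (proj1 (euler_qpoch q (be * z) hq)) HF1).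
    rewrite Cmult_1_r in L1.
    apply Cmod_lim_unique with (2 := L1).
    apply is_lim_seq_ext with
      (fun n => Cmod (qpoch (al * z) q n * F 0%nat
                      - qpoch_inf (al * z) q * F 0%nat));
      [intros n; now rewrite HFN|].
    apply (Cmod_mult_lim (qpoch (al * z) q) (fun _ => F 0%nat));
      [exact (proj1 (euler_qpoch q (al * z) hq))|].
    apply is_lim_seq_ext with (fun _ => 0%R); [|apply is_lim_seq_const].
    intros n; replace (F 0%nat - F 0%nat) with (RtoC 0) by ring.
    now rewrite Cmod_0.
Qed.

Lemma qpoch_inf_0 (q : C) : qpoch_inf 0 q = 1.
Proof.
  apply Clim_Cmod.
  apply is_lim_seq_ext with (fun _ => 0%R); [|apply is_lim_seq_const].
  intros n; rewrite qpoch_0.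
  replace (RtoC 1 - RtoC 1) with (RtoC 0) by ring; now rewrite Cmod_0.
Qed.

Lemma qpoch_inf_split (q A : C) (n : nat) :
  (Cmod q < 1)%R -> qpoch_inf A q = qpoch A q n * qpoch_inf (A * q ^ n) q.
Proof.
  intros hq.
  assert (L := proj1 (euler_qpoch q A hq)).
  apply (is_lim_seq_incr_n _ n) in L.
  apply Cmod_lim_unique with (1 := L).
  apply is_lim_seq_ext with
    (fun k => Cmod (qpoch A q n * qpoch (A * q ^ n) q k
                    - qpoch A q n * qpoch_inf (A * q ^ n) q)).
  { intros k; now rewrite (Nat.add_comm k n), qpoch_add. }
  apply (Cmod_mult_lim (fun _ => qpoch A q n) (qpoch (A * q ^ n) q));
    [|exact (proj1 (euler_qpoch q _ hq))].
  apply is_lim_seq_ext with (fun _ => 0%R); [|apply is_lim_seq_const].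
  intros k; replace (qpoch A q n - qpoch A q n) with (RtoC 0) by ring.
  now rewrite Cmod_0.
Qed.

(** * Moments of (q^(n+1))_oo and weighted sums *)

(** On the closed unit disc Euler's series is dominated termwise by its absolute series at 1. *)
Lemma qpoch_inf_bounded (q : C) :
  (Cmod q < 1)%R ->
  exists K : R, forall A, (Cmod A <= 1)%R -> (Cmod (qpoch_inf A q) <= K)%R.
Proof.
  intros hq.
  destruct (qdiff_coef_abs_cvg q 0 1 1 (euler_coef q 1) hq
              (euler_coef_qdiff q 1 hq)) as [K HK].
  { rewrite Cmult_0_l, Cmod_0; lra. }
  exists K; intros A HA.
  apply Cmod_series_le with (2 := proj2 (euler_qpoch q A hq)) (3 := HK).
  intros n; rewrite !Cmod_mult.
  apply Rmult_le_compat_l; [apply Cmod_ge_0|].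
  rewrite Cpow_1_l, Cmod_1, Cmod_pow, <- (pow1 n).
  apply pow_incr; split; [apply Cmod_ge_0|exact HA].
Qed.

(** With z = q^(k+1), the case a = 0 gives (z)_oo sum_n z^n / (q)_n = 1. Multiply by (q)_oo, split
    as (q)_k (z)_oo for the value and as (q)_n (q^(n+1))_oo inside the sum. *)
Lemma qpoch_inf_moment (q : C) (k : nat) :
  (Cmod q < 1)%R ->
  is_Cseries (fun n => qpoch_inf (q ^ (n + 1)) q * (q ^ S k) ^ n) (qpoch q q k).
Proof.
  intros hq.
  destruct (qdiff_qpoch q 1 0 (q ^ S k) (binomial_coef q 0) hq
              (binomial_coef_qdiff q 0 hq)) as (f & Hf & Ef).
  { rewrite Cmult_1_l; now apply Cmod_pow_S_lt_1. }
  rewrite Cmult_1_l, Cmult_0_l, qpoch_inf_0 in Ef.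
  assert (E : qpoch q q k = qpoch_inf q q * f).
  { rewrite (qpoch_inf_split q q k hq), <- Cmult_assoc.
    change (q * q ^ k) with (q ^ S k); rewrite Ef; ring. }
  rewrite E.
  apply is_Cseries_ext with (2 := is_Cseries_mult_l (qpoch_inf q q) _ _ Hf).
  intros n; rewrite (qpoch_inf_split q q n hq).
  unfold binomial_coef; rewrite qpoch_0, Nat.add_1_r.
  change (q * q ^ n) with (q ^ S n).
  field; now apply qpoch_qq_neq_0.
Qed.

(** The interchange common to both parts of the identity, used with [c] the coefficients of F and
    then of G. Index [k] stands for j = k + 1, the constant term being removed by [F n - 1]. *)
Lemma qpoch_inf_weighted_sum (q : C) (c F : nat -> C) :
  (Cmod q < 1)%R -> c 0%nat = 1 -> ex_series (fun j => Cmod (c j * q ^ j)) ->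
  (forall n, is_Cseries (fun j => c j * (q ^ (n + 1)) ^ j) (F n)) ->
  exists l,
    is_Cseries (fun k => c (S k) * q ^ S k * qpoch q q k) l /\
    is_Cseries (fun n => qpoch_inf (q ^ (n + 1)) q * (F n - 1)) l.
Proof.
  intros hq Hc0 Hc HF.
  destruct (qpoch_inf_bounded q hq) as [K HK].
  apply (Cseries_switch
    (fun k n => c (S k) * q ^ S k
                * (qpoch_inf (q ^ (n + 1)) q * (q ^ S k) ^ n))
    (fun k => Cmod (c (S k) * q ^ S k)) (fun n => (K * Cmod q ^ n)%R)).
  - now apply (ex_series_incr_1 (V := R_NormedModule)
                 (fun j => Cmod (c j * q ^ j))).
  - exists (K * / (1 - Cmod q))%R.
    apply (is_series_scal (V := R_NormedModule) K (fun n => Cmod q ^ n)%R).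
    apply is_series_geom; rewrite Rabs_pos_eq; [exact hq|apply Cmod_ge_0].
  - intros k n; rewrite Cmod_mult.
    apply Rmult_le_compat_l; [apply Cmod_ge_0|].
    rewrite Cmod_mult.
    apply Rmult_le_compat; try apply Cmod_ge_0.
    + apply HK; now apply Cmod_pow_le_1.
    + rewrite Cmod_pow; apply pow_incr; split; [apply Cmod_ge_0|].
      simpl; rewrite Cmod_mult.
      assert (H := Cmod_pow_le_1 q k hq).
      assert (H0 := Cmod_ge_0 q); nra.
  - intros k; apply is_Cseries_mult_l; now apply qpoch_inf_moment.
  - intros n.
    assert (T := is_Cseries_tail _ _ (HF n)).
    cbv beta in T; rewrite Hc0 in T; simpl (_ ^ 0) in T; rewrite Cmult_1_l in T.
    apply is_Cseries_ext with
      (2 := is_Cseries_mult_l (qpoch_inf (q ^ (n + 1)) q) _ _ T).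
    intros j.
    (* Separating [q ^ S j] leaves the [n]-th power of [q ^ S j], as the moment formula requires. *)
    replace ((q ^ (n + 1)) ^ S j) with (q ^ S j * (q ^ S j) ^ n).
    + ring.
    + rewrite <- !Cpow_mult_r, <- Cpow_add_r; f_equal; lia.
Qed.

(** * The product expansion and the final identity *)

Lemma Cconv_power (u v : nat -> C) (z : C) (k : nat) :
  Cconv (fun n => u n * z ^ n) (fun n => v n * z ^ n) k = Cconv u v k * z ^ k.
Proof.
  unfold Cconv.
  rewrite <- (sum_n_mult_r (K := C_Ring) (z ^ k)).
  apply (sum_n_ext_loc (G := C_AbelianGroup)); intros n Hn.
  unfold mult; simpl.
  replace (z ^ k) with (z ^ n * z ^ (k - n)) by
    (rewrite <- Cpow_add_r; f_equal; lia).
  ring.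
Qed.

(** The coefficient of z^j in (bz/q)_oo (dz/q)_oo / (z)_oo. *)
Definition product_coef (q b d : C) : nat -> C :=
  Cconv (euler_coef q (d / q)) (binomial_coef q (b / q)).

Lemma product_coef_series (q b d z : C) :
  (Cmod q < 1)%R -> (Cmod z < 1)%R ->
  ex_series (fun j => Cmod (product_coef q b d j * z ^ j)) /\
  exists f, is_Cseries (fun j => product_coef q b d j * z ^ j) f /\
    qpoch_inf z q * f = qpoch_inf (b / q * z) q * qpoch_inf (d / q * z) q.
Proof.
  intros hq hz.
  assert (Hd := euler_coef_qdiff q (d / q) hq).
  assert (Hb := binomial_coef_qdiff q (b / q) hq).
  assert (Zd : (Cmod (0 * z) < 1)%R) by (rewrite Cmult_0_l, Cmod_0; lra).
  assert (Zb : (Cmod (1 * z) < 1)%R) by now rewrite Cmult_1_l.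
  destruct (qdiff_qpoch q _ _ z _ hq Hd Zd) as (fd & Sd & Ed).
  destruct (qdiff_qpoch q _ _ z _ hq Hb Zb) as (fb & Sb & Eb).
  destruct (is_Cseries_conv _ _ _ _ Sd Sb
              (qdiff_coef_abs_cvg _ _ _ z _ hq Hd Zd)
              (qdiff_coef_abs_cvg _ _ _ z _ hq Hb Zb)) as [S A].
  split.
  - eapply ex_series_ext; [|exact A]; intros k.
    simpl; now rewrite Cconv_power.
  - exists (fd * fb); split.
    + apply is_Cseries_ext with (2 := S); intros k; apply Cconv_power.
    + rewrite Cmult_0_l, qpoch_inf_0, Cmult_1_l in Ed.
      rewrite Cmult_1_l in Eb.
      rewrite <- Eb, <- Ed; ring.
Qed.

Theorem theorem5p1 (q b d : C) (hq : (Cmod q < 1)%R) (hq0 : q <> 0) :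
  exists S1 S2 : C,
    is_series (V := C_NormedModule)
      (fun k : nat =>
         let j := S k in
         q ^ j / (1 - q ^ j) *
         sum_n (fun n : nat =>
                  qbinom q j n * qpoch (b / q) q (j - n) *
                  (- d / q) ^ n * q ^ (n * (n - 1) / 2)) j)
      S1 /\
    is_series (V := C_NormedModule)
      (fun k : nat =>
         let j := S k in
         (- (1)) ^ j * q ^ (j * (j + 1) / 2) / (1 - q ^ j))
      S2 /\
    is_series (V := C_NormedModule)
      (fun n : nat =>
         qpoch_inf (b * q ^ n) q * qpoch_inf (d * q ^ n) q -
         qpoch_inf (q ^ (n + 1)) q ^ 2)
      (S1 - S2).
Proof.
  assert (Hz : forall n, (Cmod (q ^ (n + 1)) < 1)%R)
    by (intros n; rewrite Nat.add_1_r; now apply Cmod_pow_S_lt_1).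
  set (F := fun n => Clim (sum_n (G := C_AbelianGroup)
              (fun j => product_coef q b d j * (q ^ (n + 1)) ^ j))).
  assert (HF : forall n,
    is_Cseries (fun j => product_coef q b d j * (q ^ (n + 1)) ^ j) (F n)).
  { intros n; apply is_Cseries_Clim.
    destruct (product_coef_series q b d _ hq (Hz n)) as (_ & f & Hf & _).
    now exists f. }
  assert (EF : forall n, qpoch_inf (q ^ (n + 1)) q * F n
                         = qpoch_inf (b * q ^ n) q * qpoch_inf (d * q ^ n) q).
  { intros n.
    destruct (product_coef_series q b d _ hq (Hz n)) as (_ & f & Hf & Ef).
    rewrite (is_Cseries_unique _ _ _ (HF n) Hf), Ef, Nat.add_1_r, Cpow_S.
    (* Here [b / q * q ^ (n + 1)] becomes [b * q ^ n], and likewise for [d]. *)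
    f_equal; f_equal; field; exact hq0. }
  destruct (qpoch_inf_weighted_sum q (product_coef q b d) F)
    as (S1 & HS1 & HL1); [exact hq| | |exact HF|].
  { unfold product_coef, Cconv; rewrite sum_O.
    unfold euler_coef, binomial_coef; simpl; field. }
  { exact (proj1 (product_coef_series q b d q hq hq)). }
  (* Now the weighted function is (z)_oo itself, so the summand is (z)_oo ((z)_oo - 1) at z =
     q^(n+1). *)
  destruct (qpoch_inf_weighted_sum q (euler_coef q 1)
              (fun n => qpoch_inf (q ^ (n + 1)) q))
    as (S2 & HS2 & HL2); [exact hq| | | |].
  { apply (euler_coef_qdiff q 1 hq). }
  { apply (qdiff_coef_abs_cvg q 0 1 q _ hq (euler_coef_qdiff q 1 hq)).
    rewrite Cmult_0_l, Cmod_0; lra. }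
  { intros n; apply (euler_qpoch q _ hq). }
  exists S1, S2; split; [|split].
  - apply is_Cseries_ext with (2 := HS1); intros k; cbv zeta.
    unfold product_coef, Cconv.
    assert (H1 := one_minus_neq_0 _ (Cmod_pow_S_lt_1 q k hq)).
    assert (H2 := qpoch_qq_neq_0 q k hq).
    (* [qpoch q q k] is [qpoch q q (S k)] divided by [1 - q ^ S k]; the factor [qpoch q q (S k)]
       then goes into the sum and completes the Gaussian binomials. *)
    transitivity (q ^ S k / (1 - q ^ S k) * (qpoch q q (S k) *
      sum_n (G := C_AbelianGroup) (fun n => euler_coef q (d / q) n
        * binomial_coef q (b / q) (S k - n)) (S k))).
    { rewrite qpoch_qq_S; field; exact H1. }
    f_equal.
    rewrite <- (sum_n_mult_l (K := C_Ring) (qpoch q q (S k))).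
    apply (sum_n_ext_loc (G := C_AbelianGroup)); intros n Hn.
    match goal with |- mult ?x ?y = ?z => change (@eq C (Cmult x y) z) end.
    unfold qbinom, euler_coef, binomial_coef.
    replace (- d / q) with (- (d / q)) by (field; exact hq0).
    assert (H3 := qpoch_qq_neq_0 q n hq).
    assert (H4 := qpoch_qq_neq_0 q (S k - n) hq).
    field; split; assumption.
  - apply is_Cseries_ext with (2 := HS2); intros k; cbv zeta.
    assert (H1 := one_minus_neq_0 _ (Cmod_pow_S_lt_1 q k hq)).
    assert (H2 := qpoch_qq_neq_0 q k hq).
    unfold euler_coef; rewrite qpoch_qq_S.
    (* With j = k + 1, the weight q^j raises Euler's exponent j(j-1)/2 to j(j+1)/2. *)
    replace (S k * (S k + 1) / 2)%nat with (S k * (S k - 1) / 2 + S k)%nat.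
    + rewrite Cpow_add_r; field; split; assumption.
    + rewrite <- triangular_S; f_equal; lia.
  - apply is_Cseries_ext with (2 := is_Cseries_minus _ _ _ _ HL1 HL2).
    (* The terms -(z)_oo from the two weighted sums cancel. *)
    intros n; rewrite <- EF; simpl; ring.
Qed.
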